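(* Let $1\le l\le m\le n$ be integers, let $u=(u_1,\dots,u_l)\in[n]^l$ be strictly increasing with $u_i\ge n-m+i$ for all $1\le i\le l$, and let $\pi_{l+1},\dots,\pi_m\in[n]$. Let $$A_{\pi_{l+1},\dots,\pi_m}=\{v=(v_1,\dots,v_l)\in[n]^l:\ v_1<\cdots<v_l,\ (v_1,\dots,v_l,\pi_{l+1},\dots,\pi_m)\in \mathrm{PF}(m,n)\}$$ and let $[u]=\{v\in[n]^l:\ v_1<\cdots<v_l,\ v_i\le u_i \text{ for all } 1\le i\le l\}$. Then $A_{\pi_{l+1},\dots,\pi_m}=[u]$ if and only if $$(\pi_{l+1},\dots,\pi_m)\in \mathrm{MS}(m-n+u_1-1,\ u_1-1,\ u_2-u_1-1,\ \dots,\ u_l-u_{l-1}-1,\ n-u_l).$$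
   Context: Write $[n]=\{1,\dots,n\}$. For integers $0\le m\le n$, $\mathrm{PF}(m,n)$ denotes the set of parking functions with $m$ cars and $n$ spots: sequences $(\pi_1,\dots,\pi_m)\in[n]^m$ such that, when cars $1,\dots,m$ enter in order a one-way street with spots $1,\dots,n$ and car $i$ parks in spot $\pi_i$ if it is free and otherwise in the first free spot after $\pi_i$, all cars park. Equivalently, the non-decreasing rearrangement $(\lambda_1,\dots,\lambda_m)$ satisfies $\lambda_i\le n-m+i$ for all $i$. $\mathrm{PF}(0,n)$ consists of the empty sequence only. For $1\le l\le m\le n$ and strictly increasing $u=(u_1,\dots,u_l)\in[n]^l$ with $u_i\ge n-m+i$ for all $i$, the statement $(\pi_{l+1},\dots,\pi_m)\in \mathrm{MS}(m-n+u_1-1,u_1-1,u_2-u_1-1,\dots,u_l-u_{l-1}-1,n-u_l)$ (''parking function multi-shuffle'') means: there exist parking functions $\alpha_1\in \mathrm{PF}(m-n+u_1-1,u_1-1)$, $\alpha_i\in \mathrm{PF}(u_i-u_{i-1}-1,u_i-u_{i-1}-1)$ for $2\le i\le l$, and $\alpha_{l+1}\in \mathrm{PF}(n-u_l,n-u_l)$ such that the sequence $(\pi_{l+1},\dots,\pi_m)$ is a permutation (as a multiset rearrangement) of the concatenation of the $l+1$ words $\alpha_1,\ \alpha_2+(u_1,\dots,u_1),\ \dots,\ \alpha_{l+1}+(u_l,\dots,u_l)$. *)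

(* Defs.v *)
From mathcomp Require Import all_boot.
Set Implicit Arguments. Unset Strict Implicit. Unset Printing Implicit Defensive.

(* Spots and preferences are the naturals 1, ..., n, as in
   [n] = {1, ..., n}; words are sequences of naturals. *)

Definition in_spots (n : nat) (s : seq nat) : bool :=
  all (fun p => 1 <= p <= n) s.

(* [iota p (n.+1 - p)] lists the spots p, p + 1, ..., n. *)
Definition first_free (n : nat) (occ : seq nat) (p : nat) : option nat :=
  ohead [seq s <- iota p (n.+1 - p) | s \notin occ].

Fixpoint all_park (n : nat) (occ pi : seq nat) : bool :=
  if pi is p :: pi' then
    if first_free n occ p is Some s then all_park n (s :: occ) pi' else false
  else true.

Definition PF (m n : nat) : {pred seq nat} :=
  [pred pi : seq nat | [&& size pi == m, in_spots n pi & all_park n [::] pi]].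

(* The i-th entry of u, counted from 1. *)
Definition entry (u : seq nat) (i : nat) : nat := nth 0 u i.-1.

(* The set A of increasing v such that v followed by pi parks. *)
Definition completions (l m n : nat) (pi : seq nat) : {pred l.-tuple nat} :=
  [pred v : l.-tuple nat |
    [&& in_spots n v, sorted ltn v & v ++ pi \in PF m n]].

Arguments completions : clear implicits.

(* The set written [u]. *)
Definition lower_box (l n : nat) (u : l.-tuple nat) : {pred l.-tuple nat} :=
  [pred v : l.-tuple nat |
    [&& in_spots n v, sorted ltn v & [forall i : 'I_l, tnth v i <= tnth u i]]].

(* pi is a parking function multi-shuffle for u = (u_1, ..., u_l), l >= 1.
   The word alpha i is used for 1 <= i <= l + 1 only.  The number of cars
   m - n + u_1 - 1 is written m + u_1 - n - 1 so that no intermediate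
   subtraction truncates (u_1 >= n - m + 1). *)
Definition MS (l m n : nat) (u : l.-tuple nat) (pi : seq nat) : Prop :=
  exists alpha : nat -> seq nat,
    [/\ alpha 1 \in PF (m + entry u 1 - n - 1) (entry u 1 - 1),
        forall i, 2 <= i <= l ->
          alpha i \in PF (entry u i - entry u i.-1 - 1)
                         (entry u i - entry u i.-1 - 1),
        alpha l.+1 \in PF (n - entry u l) (n - entry u l)
      & perm_eq pi
          (alpha 1 ++
           flatten [seq [seq entry u i.-1 + a | a <- alpha i]
                   | i <- iota 2 l])].

(* Main.v *)
Require Import Defs.
From mathcomp Require Import all_boot.
From mathcomp Require Import zify.

(* Write N_w(j) for the number of letters of w exceeding j.  A word of spots
   parks iff N_w(j) + j <= n for all j <= n, so a completion v is an increasing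
   word with N_v(j) <= n - j - N_pi(j), while v lies in the box of u iff
   N_v <= N_u pointwise.  Hence the two sets agree iff u is a completion and the
   constraint is tight at every j = u_i: where it is not tight, some u_i can be
   raised.  Tightness at the u_i says that pi avoids u and that its restriction
   to each gap between consecutive u_i is a parking function of the right size,
   which is the multi-shuffle condition. *)

Set Implicit Arguments.
Unset Strict Implicit.
Unset Printing Implicit Defensive.

(** * Parking as a bound on the number of letters above each threshold *)

Lemma ohead_filter_iota (a : pred nat) p k :
  if ohead [seq s <- iota p k | a s] is Some s then
    [/\ p <= s < p + k, a s & forall x, p <= x < s -> ~~ a x]
  else forall x, p <= x < p + k -> ~~ a x.
Proof.
elim: k p => [|k IHk] p /=; first by move=> x; lia.
case: ifP => [ap|/negbT nap] /=.
  by split=> //; [lia | move=> x; lia].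
have := IHk p.+1; case: (ohead _) => [s [ps as_ nax]|nax].
  split=> //; first by lia.
  move=> x /andP[]; rewrite leq_eqVlt => /orP[/eqP <- //|px xs].
  by apply: nax; rewrite px.
move=> x /andP[]; rewrite leq_eqVlt => /orP[/eqP <- //|px xk].
by apply: nax; lia.
Qed.

Lemma count_gt_split (s : seq nat) (a b : nat) : a <= b ->
  count (ltn a) s = count (ltn b) s + count (fun x => a < x <= b) s.
Proof. by move=> leab; elim: s => //= x s ->; lia. Qed.

Lemma count_gt_uniq_le n (s : seq nat) j : uniq s -> in_spots n s ->
  j <= n -> count (ltn j) s + j <= n.
Proof.
move=> Us /allP sn lejn.
suff: size (filter (ltn j) s) <= size (iota j.+1 (n - j)).
  by rewrite size_filter size_iota; lia.
apply: uniq_leq_size; first exact: filter_uniq.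
by move=> x; rewrite mem_filter mem_iota /= => /andP[jx /sn]; lia.
Qed.

(** The [b - a] spots are distinct, so each accounts for its own letter counted at [a] but not at
    [b]. *)
Lemma count_gt_filled (s : seq nat) a b : a <= b ->
  (forall x, a < x <= b -> x \in s) ->
  count (ltn b) s + (b - a) <= count (ltn a) s.
Proof.
move=> leab sP; rewrite (count_gt_split s leab) leq_add2l -size_filter.
rewrite -[leqLHS](size_iota a.+1) uniq_leq_size ?iota_uniq // => x.
rewrite mem_iota mem_filter => xab; have {}xab : a < x <= b by lia.
by rewrite xab sP.
Qed.

(* A parked car counts as a car preferring exactly the spot it occupies. *)
Lemma all_parkP n (occ pi : seq nat) : uniq occ -> in_spots n occ ->
  in_spots n pi ->
  reflect (forall j, j <= n -> count (ltn j) (occ ++ pi) + j <= n)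
          (all_park n occ pi).
Proof.
elim: pi occ => [|p pi IHpi] occ Uocc occn /=.
  by move=> _; apply: ReflectT => j; rewrite cats0; apply: count_gt_uniq_le.
case/andP=> pn pin; rewrite /first_free.
have := ohead_filter_iota [predC occ] p (n.+1 - p); rewrite /=.
case: (ohead _) => [s [sb socc filled]|filled]; last first.
  (* With [p], ..., [n] all occupied, the car preferring [p] is one letter too many above [p.-1]. *)
  apply: ReflectF => /(_ p.-1); rewrite count_cat /=.
  have le1 : p.-1 <= n by lia.
  have /(count_gt_filled le1) : forall x, p.-1 < x <= n -> x \in occ.
    by move=> x xb; rewrite -[_ \in _]negbK filled; lia.
  by lia.
apply: (iffP (IHpi (s :: occ) _ _ pin)) => /=; first by rewrite socc.
- by apply/andP; split=> //; lia.
- by move=> le_n j /le_n; rewrite !count_cat /=; lia.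
move=> le_n j jn; have := le_n j jn; rewrite !count_cat /=.
(* The counts with [s] and with [p] differ only for [p <= j < s]; there the bound at [p.-1]
   suffices, since [p], ..., [j] are occupied. *)
have [pjs|] := boolP (p <= j < s); last by lia.
have := le_n p.-1; rewrite count_cat /=.
have le1 : p.-1 <= j by lia.
have /(count_gt_filled le1) : forall x, p.-1 < x <= j -> x \in occ.
  by move=> x xb; rewrite -[_ \in _]negbK filled; lia.
by have := count_gt_split pi le1; lia.
Qed.

Lemma PF_countP m n (pi : seq nat) :
  reflect [/\ size pi = m, in_spots n pi
            & forall j, j <= n -> count (ltn j) pi + j <= n]
          (pi \in PF m n).
Proof.
rewrite inE; apply: (iffP and3P) => -[/eqP sz pin].
  by move/(@all_parkP n [::] pi isT isT pin).
by move=> le_n; split=> //; apply/(@all_parkP n [::] pi).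
Qed.

(** Translation by [c] places the spots strictly between [c] and [d], so that a block can be tested
    in the coordinates of the whole street. *)
Lemma PF_shift k c d (a : seq nat) : c < d ->
  a \in PF k (d - c - 1) <->
  [/\ size a = k, all (fun x => c < x < d) (map (addn c) a)
    & forall j, c <= j < d -> count (ltn j) (map (addn c) a) + j < d].
Proof.
move=> cd.
have cnt j : c <= j ->
    count (ltn j) (map (addn c) a) = count (ltn (j - c)) a.
  by move=> cj; rewrite count_map; apply: eq_count => x /=; lia.
have spots : all (fun x => c < x < d) (map (addn c) a) = in_spots (d - c - 1) a.
  by rewrite all_map; apply: eq_all => x /=; lia.
rewrite spots; split=> [/PF_countP|] [sz an le_d].
  split=> // j jb; rewrite cnt; last by lia.
  by have := le_d (j - c); lia.
apply/PF_countP; split=> // j jb; have := le_d (j + c); rewrite cnt; last by lia.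
by rewrite addnK; lia.
Qed.

(** * Counting letters of increasing words *)

Lemma count_gt_cut (s : seq nat) k j : k <= size s ->
  (forall i, i < k -> nth 0 s i <= j) ->
  (forall i, k <= i < size s -> j < nth 0 s i) ->
  count (ltn j) s = size s - k.
Proof.
move=> ks lo hi; rewrite -{1}(cat_take_drop k s) count_cat.
have /eqP-> : count (ltn j) (take k s) == 0.
  rewrite -leqn0 leqNgt -has_count -all_predC; apply/(all_nthP 0) => i.
  by rewrite size_takel // => ik; rewrite nth_take //= -leqNgt lo.
have /eqP-> : count (ltn j) (drop k s) == size (drop k s).
  rewrite -all_count; apply/(all_nthP 0) => i.
  by rewrite size_drop nth_drop => ik; apply: hi; lia.
by rewrite size_drop.
Qed.

Lemma ltn_sorted_nth (s : seq nat) i j : sorted ltn s -> j < size s ->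
  i < j -> nth 0 s i < nth 0 s j.
Proof.
by move=> ss js ij; apply: (sorted_ltn_nth ltn_trans 0 ss); rewrite ?inE; lia.
Qed.

Lemma count_gt_nth (s : seq nat) i : sorted ltn s -> i < size s ->
  count (ltn (nth 0 s i)) s = size s - i.+1.
Proof.
move=> ss si; apply: count_gt_cut => // k.
  rewrite ltnS leq_eqVlt => /orP[/eqP-> //|ki].
  exact: ltnW (ltn_sorted_nth ss si ki).
by case/andP=> ik ks; apply: ltn_sorted_nth.
Qed.

Lemma leq_count_gt (s t : seq nat) j : size s = size t ->
  (forall i, nth 0 s i <= nth 0 t i) -> count (ltn j) s <= count (ltn j) t.
Proof.
elim: s t => [|x s IHs] [|y t] //= [sz] le_st.
by have := IHs t sz (fun i => le_st i.+1); have := le_st 0; rewrite /=; lia.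
Qed.

(** If entry [i] exceeded [a], so would every later entry, giving [size s - i] letters above [a],
    one too many. *)
Lemma nth_le_of_count (s : seq nat) i a : sorted ltn s -> i < size s ->
  count (ltn a) s <= size s - i.+1 -> nth 0 s i <= a.
Proof.
move=> ss si; apply: contraTT; rewrite -!ltnNge => lt_a.
rewrite -{2}(cat_take_drop i s) count_cat.
suff /eqP-> : count (ltn a) (drop i s) == size (drop i s).
  by rewrite size_drop; lia.
rewrite -all_count; apply/(all_nthP 0) => k.
rewrite size_drop nth_drop => ks /=; case: k ks => [|k] ks; first by rewrite addn0.
by apply: ltn_trans lt_a _; apply: ltn_sorted_nth => //; lia.
Qed.

(** * Tightness and equality of the two sets *)

(** The first clause is the counting bound for a completion. The second is its reverse at an entry
    of [u], with [size u - i.+1] standing for the number of letters of [u] above that entry. *)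
Definition tight n (u pi : seq nat) : Prop :=
  (forall j, j <= n -> count (ltn j) u + count (ltn j) pi + j <= n) /\
  (forall i, i < size u ->
     n <= count (ltn (nth 0 u i)) pi + (size u - i.+1) + nth 0 u i).

Lemma in_spots_nth n (s : seq nat) i : in_spots n s -> i < size s ->
  0 < nth 0 s i <= n.
Proof. by move=> /(all_nthP 0) sn /sn. Qed.

Lemma completionsP l m n (v : l.-tuple nat) (pi : (m - l).-tuple nat) :
  l <= m -> in_spots n pi ->
  reflect [/\ in_spots n v, sorted ltn v
            & forall j, j <= n -> count (ltn j) v + count (ltn j) pi + j <= n]
          (v \in completions l m n pi).
Proof.
move=> lm pin; rewrite inE; apply: (iffP and3P) => -[vn vs].
  by case/PF_countP=> _ _ le_n; split=> // j /le_n; rewrite count_cat.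
move=> le_n; split=> //; apply/PF_countP; split.
- by rewrite size_cat !size_tuple subnKC.
- by rewrite /in_spots all_cat; apply/andP.
- by move=> j /le_n; rewrite count_cat.
Qed.

Lemma lower_boxP l n (u v : l.-tuple nat) :
  reflect [/\ in_spots n v, sorted ltn v & forall i, nth 0 v i <= nth 0 u i]
          (v \in lower_box n u).
Proof.
rewrite inE; apply: (iffP and3P) => -[vn vs].
  move=> /forallP le_vu; split=> // i; case: (ltnP i l) => [il|li].
    by have := le_vu (Ordinal il); rewrite !(tnth_nth 0).
  by rewrite nth_default ?size_tuple.
by move=> le_vu; split=> //; apply/forallP => i; rewrite !(tnth_nth 0).
Qed.

(** Tightness at entry [i] of [u] leaves a completion at most [l - i.+1] letters above it, so entry
    [i] of [v] cannot be larger. Conversely, lowering entries only lowers counts. *)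
Lemma tight_completions l m n (u : l.-tuple nat) (pi : (m - l).-tuple nat) :
  l <= m -> in_spots n u -> sorted ltn u -> in_spots n pi ->
  tight n u pi -> completions l m n pi =i lower_box n u.
Proof.
move=> lm un us pin [le_n ge_n] v.
apply/(completionsP _ lm pin)/lower_boxP => -[vn vs le_v]; split=> //.
  move=> i; case: (ltnP i l) => [il|li]; last by rewrite nth_default ?size_tuple.
  apply: nth_le_of_count => //; rewrite ?size_tuple //.
  have iu : i < size u by rewrite size_tuple.
  have := in_spots_nth un iu; have := ge_n i iu; have := le_v (nth 0 u i).
  by rewrite size_tuple; lia.
move=> j jn; have := le_n j jn.
have := @leq_count_gt v u j; rewrite !size_tuple => /(_ erefl le_v); lia.
Qed.

Lemma bump_sorted (u : seq nat) i : sorted ltn u -> i < size u ->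
  (i.+1 < size u -> (nth 0 u i).+1 < nth 0 u i.+1) ->
  sorted ltn (set_nth 0 u i (nth 0 u i).+1).
Proof.
move=> /(sortedP 0) us iu gap; apply/(sortedP 0) => k.
rewrite size_set_nth (maxn_idPr iu) => ku; have := us k ku.
rewrite !nth_set_nth /=; case: eqP => [eki|_].
  by subst k; case: eqP; lia.
by case: eqP => [eki|_]; subst; lia.
Qed.

Lemma count_bump (u : seq nat) i j : i < size u ->
  count (ltn j) (set_nth 0 u i (nth 0 u i).+1) =
  count (ltn j) u + (j == nth 0 u i).
Proof.
move=> iu; rewrite set_nthE iu -{4}(cat_take_drop i u) (drop_nth 0 iu).
by rewrite !count_cat /=; lia.
Qed.

Lemma in_spots_bump n (u : seq nat) i : in_spots n u -> i < size u ->
  nth 0 u i < n -> in_spots n (set_nth 0 u i (nth 0 u i).+1).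
Proof.
move=> un iu lt_n; apply/(all_nthP 0) => k.
rewrite size_set_nth (maxn_idPr iu) nth_set_nth /= => ku.
by case: eqP => _; [lia | exact: in_spots_nth].
Qed.

(* Otherwise entry [i] of [u] could be raised by one, giving a completion outside
   the box. *)
Lemma completions_tight_at l m n (u : l.-tuple nat) (pi : (m - l).-tuple nat) i :
  l <= m -> in_spots n u -> sorted ltn u -> in_spots n pi ->
  completions l m n pi =i lower_box n u ->
  i < l -> nth 0 u i < n -> (i.+1 < l -> (nth 0 u i).+1 < nth 0 u i.+1) ->
  n <= count (ltn (nth 0 u i)) pi + (l - i.+1) + nth 0 u i.
Proof.
move=> lm un us pin Abox il lt_n gap; rewrite leqNgt; apply/negP => loose.
have /(completionsP _ lm pin)[_ _ le_n] : u \in completions l m n pi.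
  by rewrite Abox; apply/lower_boxP.
have iu : i < size u by rewrite size_tuple.
have szv : size (set_nth 0 u i (nth 0 u i).+1) == l.
  by rewrite size_set_nth (maxn_idPr iu) size_tuple.
have : Tuple szv \in completions l m n pi.
  apply/(completionsP _ lm pin); split; first exact: in_spots_bump.
    by apply: bump_sorted => //; rewrite size_tuple.
  (* Raising entry [i] adds a letter only at the threshold equal to its old value, where the assumed
     slack absorbs it. *)
  move=> j jn; rewrite [X in count _ X]/= count_bump //.
  have := le_n j jn; case: eqP => [->|_]; last by lia.
  by rewrite count_gt_nth // size_tuple; lia.
rewrite Abox => /lower_boxP[_ _ /(_ i)] /=.
by rewrite nth_set_nth /= eqxx; lia.
Qed.

(** Descending induction on [i]: an entry equal to [n] is trivially tight, one that can be raised is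
    tight by [completions_tight_at], and one directly below its successor inherits tightness from
    it. *)
Lemma completions_tight l m n (u : l.-tuple nat) (pi : (m - l).-tuple nat) :
  l <= m -> in_spots n u -> sorted ltn u -> in_spots n pi ->
  completions l m n pi =i lower_box n u -> tight n u pi.
Proof.
move=> lm un us pin Abox.
have /(completionsP _ lm pin)[_ _ le_n] : u \in completions l m n pi.
  by rewrite Abox; apply/lower_boxP.
split=> // i; rewrite size_tuple.
have [k] := ubnP (l - i); elim: k i => // k IHk i ltk il.
have iu : i < size u by rewrite size_tuple.
have [|lt_n] := leqP n (nth 0 u i); first by lia.
have [li|il1] := leqP l i.+1.
  by apply: completions_tight_at => //; lia.
have iu1 : i.+1 < size u by rewrite size_tuple.
have := ltn_sorted_nth us iu1 (ltnSn i).
rewrite leq_eqVlt => /orP[/eqP eu|gap]; last exact: completions_tight_at.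
have := IHk i.+1; rewrite -eu.
have := count_gt_split pi (leqnSn (nth 0 u i)); lia.
Qed.

(* The endpoints [0 = u_0 < u_1 < ... < u_l < u_(l+1) = n + 1] of the blocks. *)
Definition endpoint n (u : seq nat) i := nth n.+1 (0 :: u) i.

(** * The blocks cut out by [u] *)

Section Blocks.

Variables (n : nat) (u : seq nat).
Hypotheses (un : in_spots n u) (us : sorted ltn u).

Local Notation l := (size u).
Local Notation b := (endpoint n u).

Lemma endpointS i : i < l -> b i.+1 = nth 0 u i.
Proof. by move=> il; rewrite /endpoint /= (set_nth_default 0). Qed.

Lemma endpoint_entry i : 0 < i <= l -> b i = entry u i.
Proof. by case: i => // i il; rewrite endpointS. Qed.

Lemma endpoint_last : b l.+1 = n.+1.
Proof. by rewrite /endpoint /= nth_default. Qed.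

Lemma endpoint_lt i : i <= l -> b i < b i.+1.
Proof.
rewrite leq_eqVlt => /orP[/eqP->|il].
  rewrite endpoint_last ltnS /endpoint; case El: l => [|k] //=.
  have kl : k < l by rewrite El.
  by rewrite (set_nth_default 0) //; case/andP: (in_spots_nth un kl).
rewrite endpointS //; case: i il => [|i] il.
  by case/andP: (in_spots_nth un il).
by rewrite endpointS ?ltn_sorted_nth //; lia.
Qed.

Lemma endpoint_le i : i <= l -> b i <= n.
Proof.
case: i => [|i] il; first by [].
by rewrite endpointS //; case/andP: (in_spots_nth un il).
Qed.

(** No entry of [u] lies strictly inside a block, so the count keeps its value at the left
    endpoint. *)
Lemma count_gt_block i j : i <= l -> b i <= j < b i.+1 ->
  count (ltn j) u = l - i.
Proof.
move=> il /andP[bj jb]; apply: count_gt_cut => // k.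
  case: i il bj {jb} => // i il; rewrite endpointS // => ij.
  rewrite ltnS leq_eqVlt => /orP[/eqP-> //|ki].
  by apply: leq_trans ij; apply/ltnW/ltn_sorted_nth.
case/andP=> ik kl; move: jb; rewrite endpointS; last by lia.
move=> /leq_trans-> //; move: ik; rewrite leq_eqVlt => /orP[/eqP-> //|ik].
by apply/ltnW/ltn_sorted_nth.
Qed.

(** The criterion of [PF_shift] with the number of cars left open. *)
Definition block_word c d (s : seq nat) : Prop :=
  all (fun x => c < x < d) s /\ forall j, c <= j < d -> count (ltn j) s + j < d.

(* [F i] lives strictly between [u_(i-1)] and [u_i].  Only the first block may
   miss cars; its size is forced by that of [pi]. *)
Definition block_decomp (pi : seq nat) (F : nat -> seq nat) : Prop :=
  [/\ forall i, i <= l -> block_word (b i) (b i.+1) (F i.+1),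
      forall i, 0 < i <= l -> size (F i.+1) = b i.+1 - b i - 1
    & perm_eq pi (flatten [seq F i | i <- iota 1 l.+1])].

(** * From a block decomposition to tightness *)

Section FromBlocks.

Variables (pi : seq nat) (F : nat -> seq nat).
Hypothesis Fpi : block_decomp pi F.

Local Notation tail i := (flatten [seq F k | k <- iota i.+1 (l.+1 - i)]).

Lemma tailE i : i <= l -> tail i = F i.+1 ++ tail i.+1.
Proof. by move=> il; rewrite subSn. Qed.

(** Induction from the last block backwards. The properties proved with it are guarded by [i <= l],
    so the case [l.+1] is vacuous and the last block is treated in the step. *)
Lemma tail_ind (P : nat -> Prop) :
  P l.+1 -> (forall i, i <= l -> P i.+1 -> P i) -> forall i, i <= l.+1 -> P i.
Proof.
move=> Pl PS i il; rewrite -(subKn il).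
elim: (l.+1 - i) (leq_subr i l.+1) => [|k IHk] kl; first by rewrite subn0.
by apply: PS; rewrite ?subnSK //; [lia | apply: IHk; lia].
Qed.

(** Every block after the first is full, so its letters and the remaining entries of [u] use up all
    spots beyond [b i]. *)
Lemma size_tail i : 0 < i <= l -> size (tail i) + b i + (l - i) = n.
Proof.
have [_ szF _] := Fpi; case/andP=> i0 il.
have: 0 < i <= l -> size (tail i) + b i + (l - i) = n; last by apply; lia.
have: i <= l.+1 by lia.
move: i {i0 il}; apply: tail_ind => [|i il IH ib]; first by lia.
rewrite tailE // size_cat szF //; have := endpoint_lt il.
move: il; rewrite leq_eqVlt => /orP[/eqP il|il]; last by have := IH il; lia.
by rewrite {2 3}il endpoint_last !il subnn /=; lia.
Qed.

Lemma tail_gt i : i <= l -> all (ltn (b i)) (tail i).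
Proof.
move=> il; have [Fb _ _] := Fpi.
have: i <= l -> all (ltn (b i)) (tail i); last by apply.
have: i <= l.+1 by lia.
move: i {il}; apply: tail_ind => [|i il IH _]; first by lia.
have [Fi _] := Fb i il; rewrite tailE // all_cat.
apply/andP; split; first by apply: sub_all Fi => x /andP[].
move: (il); rewrite leq_eqVlt => /orP[/eqP il'|il']; first by rewrite il' subnn.
by apply: sub_all (IH il') => x /=; apply: ltn_trans; apply: endpoint_lt.
Qed.

(** For [j] inside the block, its own bound and the size of the later blocks add up to [n]; for [j]
    beyond it, the block contributes nothing and the next tail decides. *)
Lemma count_tail i j : i <= l -> b i <= j <= n ->
  count (ltn j) u + count (ltn j) (tail i) + j <= n.
Proof.
move=> il; have [Fb _ _] := Fpi.
have: i <= l -> b i <= j <= n ->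
  count (ltn j) u + count (ltn j) (tail i) + j <= n; last by apply.
have: i <= l.+1 by lia.
move: i {il}; apply: tail_ind => [|i il IH _ /andP[bj jn]]; first by lia.
have [Fi cF] := Fb i il; rewrite tailE // count_cat.
have [jb|bj1] := ltnP j (b i.+1).
  have := cF j; have := count_size (ltn j) (tail i.+1).
  rewrite (count_gt_block il) ?bj //.
  move: (il); rewrite leq_eqVlt => /orP[/eqP il'|il'].
    by rewrite il' endpoint_last subnn /=; lia.
  by have := @size_tail i.+1; lia.
have /eqP-> : count (ltn j) (F i.+1) == 0.
  rewrite -leqn0 leqNgt -has_count -all_predC.
  by apply: sub_all Fi => x /=; lia.
move: (il); rewrite leq_eqVlt => /orP[/eqP il'|il']; last by apply: IH; lia.
by move: bj1; rewrite il' endpoint_last; lia.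
Qed.

Lemma block_decomp_tight : tight n u pi.
Proof.
have [_ _ pi_perm] := Fpi; have cnt j := permP pi_perm (ltn j).
split=> [j jn|i il]; rewrite cnt.
  by have := @count_tail 0 j (leq0n l) jn; rewrite subn0.
(* Only the blocks after entry [i] matter: all their letters exceed it, and [size_tail] gives their
   number. *)
have -> : iota 1 l.+1 = iota 1 i.+1 ++ iota i.+2 (l.+1 - i.+1).
  by rewrite -[i.+2]/(1 + i.+1) -iotaD; congr iota; lia.
rewrite map_cat flatten_cat count_cat.
have := tail_gt il; rewrite all_count endpointS // => /eqP->.
by have := @size_tail i.+1; rewrite endpointS //; lia.
Qed.

End FromBlocks.

(** * From tightness to a block decomposition *)

Section ToBlocks.

Variable pi : seq nat.
Hypotheses (pi_spots : in_spots n pi) (Tpi : tight n u pi).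

Local Notation P j := (count (ltn j) pi).

Lemma tight_endpoint i : 0 < i <= l -> P (b i) + (l - i) + b i = n.
Proof.
case: i => // i il; have [le_n ge_n] := Tpi.
have := ge_n i il; have := le_n (b i.+1); have := @count_gt_nth u i us il.
have := endpoint_le il; rewrite endpointS //; lia.
Qed.

(** The parking bound one spot before the endpoint gives one inequality; tightness at the endpoint
    and monotonicity of the count give the other. At [n.+1] the bound at [n] alone suffices. *)
Lemma tight_endpoint_pred i : i <= l -> P (b i.+1 - 1) + (l - i) + b i.+1 = n.+1.
Proof.
move=> il; have [le_n _] := Tpi.
have := le_n (b i.+1 - 1); have := endpoint_lt il.
move: (il); rewrite leq_eqVlt => /orP[/eqP il'|il'].
  by rewrite il' endpoint_last; lia.
move=> lt_b; rewrite (@count_gt_block i) //; last by lia.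
have := @tight_endpoint i.+1; have := endpoint_le il'.
have le1 : b i.+1 - 1 <= b i.+1 by lia.
by have := count_gt_split pi le1; lia.
Qed.

Lemma count_block i j : i <= l -> b i <= j < b i.+1 ->
  P j = P (b i.+1 - 1) + count (fun x => j < x < b i.+1) pi.
Proof.
move=> il jb; rewrite (@count_gt_split _ j (b i.+1 - 1)); last by lia.
by congr (_ + _); apply: eq_count => x; lia.
Qed.

Definition restrict_block i := [seq x <- pi | b i.-1 < x < b i].

(** The two preceding equalities give the same count at [b i - 1] and at [b i], leaving no room for
    a letter between. *)
Lemma endpoint_notin i : 0 < i <= l -> b i \notin pi.
Proof.
case: i => // i il; have := tight_endpoint il.
have := @tight_endpoint_pred i; have lt_b := @endpoint_lt i.
have le1 : b i.+1 - 1 <= b i.+1 by lia.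
rewrite (count_gt_split pi le1) -has_pred1 has_count.
have -> : count (fun x => b i.+1 - 1 < x <= b i.+1) pi = count (pred1 (b i.+1)) pi.
  by apply: eq_count => x /=; lia.
by lia.
Qed.

Lemma perm_restrict_block i : i <= l ->
  perm_eq [seq x <- pi | b i < x]
          (flatten [seq restrict_block k | k <- iota i.+1 (l.+1 - i)]).
Proof.
move=> il.
have: i <= l -> perm_eq [seq x <- pi | b i < x]
  (flatten [seq restrict_block k | k <- iota i.+1 (l.+1 - i)]); last by apply.
have: i <= l.+1 by lia.
move: i {il}; apply: tail_ind => [|i il IH _]; first by lia.
(* Split at [b i.+1]: the letters not below it lie strictly above it because [pi] avoids endpoints,
   and beyond [n.+1] there are none. *)
rewrite subSn //= -(perm_filterC (fun x => x < b i.+1)) -!filter_predI.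
rewrite (@eq_filter _ _ (fun x => b i < x < b i.+1)); last first.
  by move=> x /=; rewrite andbC.
rewrite perm_cat2l.
move: (il); rewrite leq_eqVlt => /orP[/eqP il'|il'].
  rewrite il' subnn /= (@eq_in_filter _ _ pred0) ?filter_pred0 // => x xpi.
  by have /allP/(_ x xpi) := pi_spots; rewrite /= endpoint_last; lia.
rewrite (@eq_in_filter _ _ (fun x => b i.+1 < x)); first exact: IH.
move=> x xpi; have := @endpoint_notin i.+1; have := endpoint_lt il.
rewrite /= -leqNgt [b i.+1 <= x]leq_eqVlt; case: eqP => [->|_]; last by lia.
by rewrite xpi; lia.
Qed.

Lemma tight_block_decomp : block_decomp pi restrict_block.
Proof.
have sz i : i <= l -> size (restrict_block i.+1) + P (b i.+1 - 1) = P (b i).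
  move=> il; rewrite size_filter addnC /= -count_block //.
  by rewrite leqnn endpoint_lt.
split=> [i il|i il|].
- split=> [|j jb]; first exact: filter_all.
  rewrite count_filter (@eq_count _ _ (fun x => j < x < b i.+1)); last first.
    by move=> x /=; lia.
  (* Subtracting the equality at [b i.+1 - 1] from the parking bound at [j] leaves the bound inside
     the block. *)
  have [le_n _] := Tpi; have := le_n j; rewrite (count_gt_block il jb).
  have := tight_endpoint_pred il; have := count_block il jb.
  have : b i.+1 <= n.+1; last by lia.
  move: (il); rewrite leq_eqVlt => /orP[/eqP->|/endpoint_le]; last by lia.
  by rewrite endpoint_last.
(* For [0 < i] equality holds at both ends of the block, which makes it full. *)
- have := @sz i; have := @tight_endpoint i; have := @tight_endpoint_pred i.
  by have := @endpoint_lt i; lia.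
have := perm_restrict_block (leq0n l); rewrite subn0.
rewrite (@eq_in_filter _ _ predT) ?filter_predT // => x /(allP pi_spots).
by case/andP.
Qed.

End ToBlocks.

End Blocks.

(** * Block decompositions as multi-shuffles *)

(** Removing the full blocks from [pi] yields the car number [m - n + u_1 - 1] of the first parking
    function, here in additive form. *)
Lemma size_first_block n (u pi : seq nat) F :
  in_spots n u -> sorted ltn u -> 0 < size u -> block_decomp n u pi F ->
  size (F 1) + n + 1 = size pi + size u + endpoint n u 1.
Proof.
move=> un us u0 Fpi; have [_ _ pi_perm] := Fpi.
rewrite (perm_size pi_perm) /= size_cat.
by have := @size_tail n u un us pi F Fpi 1; rewrite subSS subn0; lia.
Qed.

Lemma MS_block_decomp l m n (u : l.-tuple nat) (pi : (m - l).-tuple nat) :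
  0 < l -> l <= m -> m <= n -> in_spots n u -> sorted ltn u ->
  MS m n u pi <-> exists F, block_decomp n u pi F.
Proof.
move=> l0 lm mn un us.
have bE i : 0 < i <= l -> entry u i = endpoint n u i.
  by move=> il; rewrite endpoint_entry ?size_tuple.
have b1 : entry u 1 = endpoint n u 1 by rewrite bE ?l0.
have bl : entry u l = endpoint n u l by rewrite bE ?l0 ?leqnn.
have blast : endpoint n u l.+1 = n.+1.
  by rewrite -{2}(size_tuple u) endpoint_last.
have blt i : i <= l -> endpoint n u i < endpoint n u i.+1.
  by move=> il; apply: endpoint_lt; rewrite ?size_tuple.
have shiftE (alpha F : nat -> seq nat) :
  (forall i, i <= l -> F i.+1 = map (addn (endpoint n u i)) (alpha i.+1)) ->
  flatten [seq F i | i <- iota 1 l.+1] =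
  alpha 1 ++ flatten [seq [seq entry u i.-1 + a | a <- alpha i] | i <- iota 2 l].
  (* The first block is translated by the endpoint [0], hence unchanged. *)
  move=> FE; rewrite /= FE // -[RHS]/(_ ++ _) map_id; congr (_ ++ flatten _).
  apply/eq_in_map => -[|i]; rewrite mem_iota; first by lia.
  by move=> il; rewrite FE ?bE //; lia.
split=> [[alpha [a1 ai al pi_perm]]|[F Fpi]].
  pose F i := map (addn (endpoint n u i.-1)) (alpha i).
  exists F; have block i k : i <= l ->
      alpha i.+1 \in PF k (endpoint n u i.+1 - endpoint n u i - 1) ->
      size (F i.+1) = k /\ block_word (endpoint n u i) (endpoint n u i.+1) (F i.+1).
    by move=> il /(PF_shift _ _ (blt i il))[]; rewrite size_map.
  have full i : 0 < i <= l ->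
      alpha i.+1 \in PF (endpoint n u i.+1 - endpoint n u i - 1)
                        (endpoint n u i.+1 - endpoint n u i - 1).
    case/andP=> i0; rewrite leq_eqVlt => /orP[/eqP eil|il].
      rewrite eil blast -bl.
      by have -> : n.+1 - entry u l - 1 = n - entry u l by lia.
    by have := ai i.+1; rewrite /= !bE ?i0 ?il ?(ltnW il) //; apply; rewrite ltnS i0.
  split; rewrite ?size_tuple.
  - move=> [_|i il]; last by have [] := block _ _ il (full i.+1 il).
    move: a1; rewrite b1 => a1.
    by have [] := block 0 (m + endpoint n u 1 - n - 1); rewrite ?subn0.
  - by move=> i /[dup] il /andP[_ il']; have [] := block _ _ il' (full i il).
  - by rewrite (shiftE alpha).
have [Fb szF pi_perm] := Fpi.
(* The truncated subtraction loses nothing: letters of a block exceed its left endpoint. *)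
pose alpha i := map (subn^~ (endpoint n u i.-1)) (F i).
have FE i : i <= l -> F i.+1 = map (addn (endpoint n u i)) (alpha i.+1).
  move=> il; rewrite -map_comp -[LHS]map_id; apply/eq_in_map => x xF /=.
  have [|/allP/(_ x xF)] := Fb i; first by rewrite size_tuple.
  by lia.
have block i : i <= l ->
    alpha i.+1 \in PF (size (F i.+1)) (endpoint n u i.+1 - endpoint n u i - 1).
  move=> il; apply/(PF_shift _ _ (blt i il)); rewrite -FE //.
  by have [] := Fb i; rewrite ?size_tuple // /alpha size_map.
have full i : 0 < i <= l ->
    alpha i.+1 \in PF (endpoint n u i.+1 - endpoint n u i - 1)
                      (endpoint n u i.+1 - endpoint n u i - 1).
  by move=> il; rewrite -{1}szF ?size_tuple //; apply: block; lia.
exists alpha; split.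
- have := size_first_block un us; rewrite size_tuple => /(_ _ _ l0 Fpi).
  have := block 0; rewrite b1 subn0 size_tuple => a1 sz1.
  suff <- : size (F 1) = m + endpoint n u 1 - n - 1 by exact: a1.
  by lia.
- case=> [|i] // il; rewrite !bE /=; try lia.
  by apply: full; lia.
- have := full l; rewrite l0 leqnn blast -bl => /(_ isT).
  by have -> : n.+1 - entry u l - 1 = n - entry u l by lia.
- by rewrite -(shiftE alpha F FE); move: pi_perm; rewrite size_tuple.
Qed.

Theorem theorem2p4 (l m n : nat) (u : l.-tuple nat) (pi : (m - l).-tuple nat)
  (l_ge1 : 1 <= l) (le_lm : l <= m) (le_mn : m <= n)
  (u_spots : in_spots n u) (u_incr : sorted ltn u)
  (u_ge : forall i : nat, 1 <= i <= l -> n - m + i <= entry u i)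
  (pi_spots : in_spots n pi) :
  completions l m n pi =i lower_box n u <-> MS m n u pi.
Proof.
rewrite (MS_block_decomp pi l_ge1 le_lm le_mn u_spots u_incr); split.
  move=> /(completions_tight le_lm u_spots u_incr pi_spots) Tpi.
  by exists (restrict_block n u pi); apply: tight_block_decomp.
by case=> F /(block_decomp_tight u_spots u_incr); apply: tight_completions.
Qed.
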